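(* Let $k\in\mathbb{Z}$. For the Conway triple $\mathcal{L}_+=T(2,2k+1)$, $\mathcal{L}_-=T(2,2k-1)$, $\mathcal{L}_0=T(2,2k)$, $$\check{\mathcal{Z}}_{2}(T(2,2k+1))-\check{\mathcal{Z}}_{2}(T(2,2k-1))\equiv-\check{\mathcal{Z}}_{2}(T(2,2k))\mod\{2\}^2.$$ Similarly, for the Conway triple $\mathcal{L}_+=T(2,2k)$, $\mathcal{L}_-=T(2,2k-2)$, $\mathcal{L}_0=T(2,2k-1)$, $$\check{\mathcal{Z}}_{2}(T(2,2k))-\check{\mathcal{Z}}_{2}(T(2,2k-2))\equiv-2[2]^2\,\check{\mathcal{Z}}_{2}(T(2,2k-1))\mod\{2\}^2[2]^2.$$
   Context: Links are oriented and framed, represented by planar diagrams with the blackboard framing (diagrams up to Reidemeister moves II and III). Put $z=q-q^{-1}$, $[d]=q^d-q^{-d}$, $\{d\}=[d]/[1]$, and let $\Lambda=\mathbb{Q}[q^{\pm1},t^{\pm1}]$ with the elements $q^k-q^{-k}$ ($k\ge1$) inverted. A Conway triple $(\mathcal{L}_+,\mathcal{L}_-,\mathcal{L}_0)$ is a triple of oriented diagrams identical except near one point, where they have a positive crossing, a negative crossing, and the oriented smoothing respectively. For $n\in\mathbb{Z}$, $T(2,n)$ is the $(2,n)$ torus link, given as the closure of the $2$-braid $\sigma_1^n$ with strands oriented in parallel ($\sigma_1$ a positive crossing) and with the blackboard framing. Framed HOMFLY-PT polynomial: $\mathcal{H}(\mathcal{L};q,t)\in\Lambda$ is the framed link invariant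 determined by: $\mathcal{H}=1$ for the empty diagram, $\mathcal{H}(U)=\frac{t-t^{-1}}{q-q^{-1}}$ for the $0$-framed unknot $U$ (and a disjoint such $U$ multiplies $\mathcal{H}$ by this scalar); $\mathcal{H}(\mathcal{L}_+)-\mathcal{H}(\mathcal{L}_-)=z\,\mathcal{H}(\mathcal{L}_0)$ for every Conway triple; adding a positive (resp. negative) kink multiplies $\mathcal{H}$ by $t$ (resp. $t^{-1}$). Skein of the annulus: $\mathcal{C}$ is the $\Lambda$-module of linear combinations of oriented link diagrams in the annulus modulo the same local relations. For $i,j\ge 0$ let $A_{i,j}\in\mathcal{C}$ be the closure of the braid $\sigma_{i+j}\cdots\sigma_{j+1}\sigma_j^{-1}\cdots\sigma_1^{-1}$ on $i+j+1$ strands, oriented along the core ($\sigma_i$ positive crossings). For $m\ge1$ define $P_m$ by $[m]P_m=z\sum_{i=0}^{m-1}A_{i,m-1-i}$. Decoration: for $\mathcal{L}$ with components $\mathcal{K}_1,\dots,\mathcal{K}_L$ and $T_\alpha\in\mathcal{C}$, $\mathcal{L}\star\otimes_{\alpha=1}^L T_\alpha$ is obtained by replacing the (framing) annulus around each $\mathcal{K}_\alpha$ by the annulus containing $T_\alpha$, core orientations matching, extended multilinearly. For a link $\mathcal{L}$ with $L$ components and $p\ge1$, $\check{\mathcal{Z}}_p(\mathcal{L})=\check{\mathcal{Z}}_p(\mathcal{L};q,t)=[p]^L\,\mathcal{H}(\mathcal{L}\star\otimes_{\alpha=1}^LP_p)$. The notation $A\equiv B\mod C$ means $\frac{A-B}{C}\in\mathbb{Z}[(q-q^{-1})^2,t^{\pm1}]$.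 *)

(* Defs.v *)
From mathcomp Require Import all_boot all_order all_algebra.
Set Implicit Arguments.
Unset Strict Implicit.
Unset Printing Implicit Defensive.
Import GRing.Theory.
Local Open Scope ring_scope.

(** * Coefficients *)

(* Q(q,t), as the fraction field of Q[q][t] *)
Definition Qqt : fieldType := {fraction {poly {poly rat}}}.

Definition q : Qqt := tofrac (('X : {poly rat})%:P : {poly {poly rat}}).
Definition t : Qqt := tofrac ('X : {poly {poly rat}}).

Definition z : Qqt := q - q^-1.
(* [d] *)
Definition qbr (d : nat) : Qqt := q ^+ d - q ^- d.
(* {d} *)
Definition qcurl (d : nat) : Qqt := qbr d / qbr 1.

(* the subring of Q(q,t) generated by G *)
Inductive subring_gen (G : Qqt -> Prop) : Qqt -> Prop :=
| subring_gen_in x : G x -> subring_gen G x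
| subring_gen1 : subring_gen G 1
| subring_genB x y :
    subring_gen G x -> subring_gen G y -> subring_gen G (x - y)
| subring_genM x y :
    subring_gen G x -> subring_gen G y -> subring_gen G (x * y).

(* Lambda = Q[q^{+-1}, t^{+-1}] with the q^k - q^{-k} (k >= 1) inverted *)
Inductive Lambda_gen : Qqt -> Prop :=
| Lambda_rat (a : rat) : Lambda_gen (ratr a)
| Lambda_q : Lambda_gen q
| Lambda_qV : Lambda_gen q^-1
| Lambda_t : Lambda_gen t
| Lambda_tV : Lambda_gen t^-1
| Lambda_qbrV k : (0 < k)%N -> Lambda_gen (qbr k)^-1.

Definition in_Lambda : Qqt -> Prop := subring_gen Lambda_gen.

(* Z[(q - q^{-1})^2, t^{+-1}] *)
Definition in_Zz2t : Qqt -> Prop :=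
  subring_gen (fun x => [\/ x = z ^+ 2, x = t | x = t^-1]).

Definition congr_mod (A B C : Qqt) : Prop := in_Zz2t ((A - B) / C).

(** * Oriented planar diagrams in Morse position

   A diagram is cut into horizontal slices, listed from bottom to top.  Each
   slice [(i, p)] contains one piece [p] with [i] vertical strands on its left.
   A horizontal level is recorded by the directions of the strands that meet
   it, from left to right ([true] = up, [false] = down). *)

Inductive piece : Type :=
| Cup of bool    (* local minimum; the left leg has the given direction *)
| Cap            (* local maximum *)
| Cross of bool. (* [true]: the strand from bottom left to top right is over *)

Definition diagram : Type := seq (nat * piece).

Definition step (s : seq bool) (x : nat * piece) : option (seq bool) :=
  match x with
  | (i, Cup o) =>
      if (i <= size s)%N then Some (take i s ++ o :: ~~ o :: drop i s) else None
  | (i, Cap) =>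
      if drop i s is a :: b :: r then
        if b == ~~ a then Some (take i s ++ r) else None
      else None
  | (i, Cross _) =>
      if drop i s is a :: b :: r then Some (take i s ++ b :: a :: r) else None
  end.

(* [run s w]: directions at the top of [w], given the directions [s] at the
   bottom; [None] if [w] is not well formed above [s] *)
Fixpoint run (s : seq bool) (w : diagram) : option (seq bool) :=
  if w is x :: w' then obind (run^~ w') (step s x) else Some s.

Definition is_link (D : diagram) : Prop := run [::] D = Some [::].

Definition width_in (p : piece) : nat := if p is Cup _ then 0 else 2.
Definition width_out (p : piece) : nat := if p is Cap then 0 else 2.

(* Planar isotopy and Reidemeister moves II and III.  The orientations and the
   positions are constrained only by well-formedness (see [framed_homfly]). *)
Inductive local_move : diagram -> diagram -> Prop :=
  (* exchange of the heights of two distant pieces *)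
| move_exchange i p j p' : (i + width_in p <= j)%N ->
    local_move [:: (j, p'); (i, p)]
               [:: (i, p); ((j - width_in p + width_out p)%N, p')]
  (* straightening of a strand *)
| move_zigzag_l i o : local_move [:: (i.+1, Cup o); (i, Cap)] [::]
| move_zigzag_r i o : local_move [:: (i, Cup o); (i.+1, Cap)] [::]
  (* a crossing slides through a local extremum of one of its strands *)
| move_swing_cup i o c :
    local_move [:: (i.+1, Cup o); (i, Cross c)]
               [:: (i, Cup o); (i.+1, Cross (~~ c))]
| move_swing_cap i c :
    local_move [:: (i, Cross c); (i.+1, Cap)]
               [:: (i.+1, Cross (~~ c)); (i, Cap)]
| move_RII i c : local_move [:: (i, Cross c); (i, Cross (~~ c))] [::]
  (* [a], [b], [c] tell whether strand 1 is over 2, 1 over 3, 2 over 3; the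
     side condition excludes the two cyclic (hence non-layered) cases *)
| move_RIII i a b c : ~~ ((a == c) && (b != a)) ->
    local_move [:: (i, Cross a); (i.+1, Cross b); (i, Cross c)]
               [:: (i.+1, Cross c); (i, Cross b); (i.+1, Cross a)].

(* [conway_triple Dp Dm D0]: a crossing is positive when a counterclockwise
   rotation by less than pi takes the direction of the over strand to that of
   the under strand; thus [Cross true] is positive when its strands are both up
   or both down, and negative when one is up and the other down (then the
   oriented smoothing is a cap below a cup). *)
Inductive conway_triple : diagram -> diagram -> diagram -> Prop :=
| conway_parallel D D' l o r :
    run [::] D = Some (l ++ [:: o, o & r]) ->
    conway_triple (D ++ (size l, Cross true) :: D')
                  (D ++ (size l, Cross false) :: D')
                  (D ++ D')
| conway_opposite D D' l o r :
    run [::] D = Some (l ++ [:: o, ~~ o & r]) ->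
    conway_triple (D ++ (size l, Cross false) :: D')
                  (D ++ (size l, Cross true) :: D')
                  (D ++ [:: (size l, Cap), (size l, Cup (~~ o)) & D']).

(* a kink, on the right or on the left of the strand at position [i]; in both
   cases its two branches have the same vertical direction at the crossing, so
   that it is positive iff [c] *)
Definition kink (right : bool) (i : nat) (o c : bool) : diagram :=
  if right then [:: (i.+1, Cup o); (i, Cross c); (i.+1, Cap)]
  else [:: (i, Cup o); (i.+1, Cross c); (i, Cap)].

(* The defining properties of the framed HOMFLY-PT polynomial; the values of
   [H] on words that are not link diagrams are irrelevant. *)
Record framed_homfly (H : diagram -> Qqt) : Prop := FramedHomfly {
  homfly_Lambda : forall D, is_link D -> in_Lambda (H D);
  homfly_invariant : forall u v D D', local_move u v ->
    is_link (D ++ u ++ D') -> is_link (D ++ v ++ D') ->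
    H (D ++ u ++ D') = H (D ++ v ++ D');
  homfly_empty : H [::] = 1;
  homfly_unknot : forall D D' i o,
    is_link (D ++ [:: (i, Cup o); (i, Cap)] ++ D') ->
    H (D ++ [:: (i, Cup o); (i, Cap)] ++ D')
      = (t - t^-1) / (q - q^-1) * H (D ++ D');
  homfly_skein : forall Dp Dm D0, conway_triple Dp Dm D0 -> is_link Dp ->
    H Dp - H Dm = z * H D0;
  homfly_kink : forall right D D' i o (c : bool),
    is_link (D ++ kink right i o c ++ D') ->
    H (D ++ kink right i o c ++ D') = (if c then t else t^-1) * H (D ++ D')
}.

(** * Closed braids *)

Definition closed_braid (n : nat) (w : diagram) : diagram :=
  [seq (i, Cup true) | i <- iota 0 n] ++ w ++
  [seq (i, Cap) | i <- rev (iota 0 n)].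

(* sigma_1^n as a 2-braid *)
Definition sigma1_pow (n : int) : diagram :=
  match n with
  | Posz m => nseq m (0%N, Cross true)
  | Negz m => nseq m.+1 (0%N, Cross false)
  end.

Definition T2 (n : int) : diagram := closed_braid 2 (sigma1_pow n).

(** * The skein of the annulus *)

(* A diagram in the annulus is cut along a radius: [(s, w)] with
   [run s w = Some s] is the closure of [w], the core pointing upwards. *)
Definition annular : Type := (seq bool * diagram)%type.

(* Representatives of elements of the skein: formal linear combinations. *)
Definition skein : Type := seq (Qqt * annular).

(* sigma_{i+j} ... sigma_{j+1} sigma_j^{-1} ... sigma_1^{-1}, where sigma_k
   sits at position k - 1 *)
Definition A_diag (i j : nat) : annular :=
  (nseq (i + j).+1 true,
   [seq (k, Cross true) | k <- rev (iota j i)] ++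
   [seq (k, Cross false) | k <- rev (iota 0 j)]).

Definition P_elt (m : nat) : skein :=
  [seq (z / qbr m, A_diag i (m.-1 - i)) | i <- iota 0 m].

(** * Components *)

Definition merge_label (a b x : nat) : nat :=
  if x == maxn a b then minn a b else x.

(* Reads a diagram from bottom to top; [s] gives the labels of the strands of
   the current level and [tbl] the labels of the cups met so far.  A new cup is
   labelled by its rank, and a cap identifies the labels of its two strands. *)
Fixpoint trace_labels (D : diagram) (s tbl : seq nat) : seq nat :=
  match D with
  | [::] => tbl
  | (i, Cup _) :: D' =>
      let n := size tbl in
      trace_labels D' (take i s ++ [:: n, n & drop i s]) (rcons tbl n)
  | (i, Cap) :: D' =>
      let m := merge_label (nth 0 s i) (nth 0 s i.+1) in
      trace_labels D' (map m (take i s ++ drop i.+2 s)) (map m tbl)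
  | (i, Cross _) :: D' =>
      trace_labels D'
        (take i s ++ [:: nth 0 s i.+1, nth 0 s i & drop i.+2 s]) tbl
  end.

(* [nth 0 (cup_labels D) n] is the least rank of a cup in the component of the
   [n]-th cup; it serves as the name of that component *)
Definition cup_labels (D : diagram) : seq nat := trace_labels D [::] [::].

Definition components (D : diagram) : seq nat := undup (cup_labels D).

(** * Decoration *)

Definition shift (k : nat) (w : diagram) : diagram :=
  [seq ((k + x.1)%N, x.2) | x <- w].

(* the parallel strands replacing a strand of direction [o] *)
Definition strands (o : bool) (T : annular) : seq bool :=
  if o then T.1 else rev (map negb T.1).

Definition cups (k : nat) (u : seq bool) : diagram :=
  [seq ((k + j)%N, Cup (nth true u j)) | j <- iota 0 (size u)].

Definition caps (k m : nat) : diagram :=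
  [seq ((k + j)%N, Cap) | j <- rev (iota 0 m)].

(* [m] parallel strands cross the [n] parallel strands on their right *)
Definition crossings (k m n : nat) (c : bool) : diagram :=
  flatten [seq [seq ((k + a + b)%N, Cross c) | b <- iota 0 n]
          | a <- rev (iota 0 m)].

(* Reads [D] from bottom to top: [n] is the number of cups already met, and [s]
   gives the components of the strands of the current level.  Every strand of
   component [a] is replaced by parallel copies according to [T a], and the
   word of [T a] is inserted once, on the upward leg of the first cup of [a]. *)
Fixpoint decorate_rec (T : nat -> annular) (lbl : seq nat)
    (n : nat) (s : seq nat) (D : diagram) : diagram :=
  let w a := size (T a).1 in
  let off i := sumn (map w (take i s)) in
  match D with
  | [::] => [::]
  | (i, Cup o) :: D' =>
      let a := nth 0 lbl n in
      cups (off i) (strands o (T a)) ++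
      (if a == n then shift (if o then off i else off i + w a)%N (T a).2
       else [::]) ++
      decorate_rec T lbl n.+1 (take i s ++ [:: a, a & drop i s]) D'
  | (i, Cap) :: D' =>
      caps (off i) (w (nth 0 s i)) ++
      decorate_rec T lbl n (take i s ++ drop i.+2 s) D'
  | (i, Cross c) :: D' =>
      crossings (off i) (w (nth 0 s i)) (w (nth 0 s i.+1)) c ++
      decorate_rec T lbl n
        (take i s ++ [:: nth 0 s i.+1, nth 0 s i & drop i.+2 s]) D'
  end.

Definition decorate (D : diagram) (T : nat -> annular) : diagram :=
  decorate_rec T (cup_labels D) 0 [::] D.

(* multilinear extension over the components in [cs], the other components
   being decorated by [T0] *)
Fixpoint star_rec (D : diagram) (cs : seq nat) (T : nat -> skein)
    (T0 : nat -> annular) : seq (Qqt * diagram) :=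
  if cs is a :: cs' then
    flatten [seq [seq (x.1 * y.1, y.2)
                 | y <- star_rec D cs' T
                          (fun b => if b == a then x.2 else T0 b)]
            | x <- T a]
  else [:: (1, decorate D T0)].

Definition star (D : diagram) (T : nat -> skein) : seq (Qqt * diagram) :=
  star_rec D (components D) T (fun=> ([::], [::])).

Definition lin_ext (H : diagram -> Qqt) (S : seq (Qqt * diagram)) : Qqt :=
  \sum_(x <- S) x.1 * H x.2.

Definition Zcheck (H : diagram -> Qqt) (p : nat) (D : diagram) : Qqt :=
  qbr p ^+ size (components D) * lin_ext H (star D (fun=> P_elt p)).

(* Main.v *)
Require Import Defs.
From Stdlib Require Import BinInt.
From mathcomp Require Import all_boot all_order all_algebra.
From mathcomp Require Import ring zify ssrZ.
Set Implicit Arguments.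
Unset Strict Implicit.
Unset Printing Implicit Defensive.
Import Order.TTheory GRing.Theory Num.Theory.
Local Open Scope ring_scope.
Local Delimit Scope Z_scope with coqZ.

(* [2] P_2 is z times the sum of the closures of sigma_1 and of its inverse, so
   the decorated T(2,n) is, up to a power of z, the closure of x beta^n, where
   beta = sigma_2 sigma_3 sigma_1 sigma_2 is the cabled crossing and x = s_1 for
   odd n, x = s_1 s_3 for even n, with s_i = sigma_i + sigma_i^-1 = 2 sigma_i - z.
   The skein relation and the moves II and III make H a linear functional on the
   Hecke algebra H_4 over Z[z], evaluated by the Markov property (kinks and
   disjoint unknots).  In H_4 one has
     (y - 1) (y^2 - (q^8 + q^-8) y + 1) (y^2 - (q^4 + q^-4) y + 1) = 0
   for y = beta^2, so the two defects in the congruences satisfy, as functions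
   of k, a palindromic linear recurrence of order 5 over Z[z^2].  Both its
   extreme coefficients are units, so it is enough to divide five consecutive
   values by the modulus; the values, like the vanishing in H_4, are computed. *)

(** * Polynomials over Z as coefficient lists *)

(** Lowest degree first, trailing zeros allowed; binary integers let the final checks run by
    [vm_compute]. *)
Definition zpoly : Type := seq Z.

Fixpoint zp_add (a b : zpoly) : zpoly :=
  match a, b with
  | [::], _ => b
  | _, [::] => a
  | x :: a', y :: b' => Z.add x y :: zp_add a' b'
  end.

Definition zp_scale (c : Z) (a : zpoly) : zpoly := map (Z.mul c) a.

Fixpoint zp_mul (a b : zpoly) : zpoly :=
  if a is x :: a' then zp_add (zp_scale x b) (Z0 :: zp_mul a' b) else [::].

Definition zp_zero (a : zpoly) : bool := all (Z.eqb Z0) a.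

(* quotient and remainder by X + 4, by Horner's scheme *)
Fixpoint zp_div4 (a : zpoly) : zpoly * Z :=
  if a is c :: a' then
    let qr := zp_div4 a' in (qr.2 :: qr.1, Z.sub c (Z.mul 4 qr.2))
  else ([::], Z0).

Fixpoint zp_dvd4 (b : nat) (a : zpoly) : bool :=
  if b is b'.+1 then
    let qr := zp_div4 a in Z.eqb Z0 qr.2 && zp_dvd4 b' qr.1
  else true.

Fixpoint zp_evens (a : zpoly) : zpoly :=
  if a is c :: a' then
    c :: (if a' is _ :: a'' then zp_evens a'' else [::])
  else [::].

Fixpoint zp_is_even (a : zpoly) : bool :=
  if a is _ :: a' then
    (if a' is c :: a'' then Z.eqb Z0 c && zp_is_even a'' else true)
  else true.

(* divisibility by X^k (X^2 + 4)^b with a quotient in Z[X^2] *)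
Definition zp_dvd (k b : nat) (a : zpoly) : bool :=
  [&& zp_zero (take k a), zp_is_even (drop k a)
    & zp_dvd4 b (zp_evens (drop k a))].

Local Arguments Z.mul : simpl never.
Local Arguments Z.sub : simpl never.

Lemma eqb0_eq c : Z.eqb Z0 c -> c = Z0.
Proof. by case: c. Qed.

Section Evaluation.
Variable R : comNzRingType.
Implicit Types (x : R) (a b : zpoly).

Definition zeval (c : Z) : R := (int_of_Z c)%:~R.

Lemma zevalD c d : zeval (Z.add c d) = zeval c + zeval d.
Proof. by rewrite /zeval -intrD -(rmorphD int_of_Z). Qed.

Lemma zevalM c d : zeval (Z.mul c d) = zeval c * zeval d.
Proof. by rewrite /zeval -intrM -(rmorphM int_of_Z). Qed.

Lemma zevalB c d : zeval (Z.sub c d) = zeval c - zeval d.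
Proof. by rewrite /zeval -intrB -(rmorphB int_of_Z). Qed.

Lemma zeval0 : zeval Z0 = 0. Proof. by []. Qed.
Lemma zeval1 : zeval 1 = 1. Proof. by []. Qed.

Fixpoint pev x a : R := if a is c :: a' then zeval c + x * pev x a' else 0.

Lemma pev_add x a b : pev x (zp_add a b) = pev x a + pev x b.
Proof.
elim: a b => [|c a IH] [|d b] /=; rewrite ?add0r ?addr0 //.
by rewrite IH zevalD; ring.
Qed.

Lemma pev_scale x c a : pev x (zp_scale c a) = zeval c * pev x a.
Proof. by elim: a => [|d a IH] /=; rewrite ?mulr0 // IH zevalM; ring. Qed.

Lemma pev_mul x a b : pev x (zp_mul a b) = pev x a * pev x b.
Proof.
elim: a => [|c a IH] /=; first by rewrite mul0r.
by rewrite pev_add pev_scale /= IH /zeval /=; ring.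
Qed.

Lemma pev_zero x a : zp_zero a -> pev x a = 0.
Proof.
by elim: a => //= c a IH /andP[/eqb0_eq-> /IH ->]; rewrite /zeval mulr0 addr0.
Qed.

Lemma pev_cat x a b : pev x (a ++ b) = pev x a + x ^+ size a * pev x b.
Proof.
by elim: a => [|c a IH] /=; rewrite ?add0r ?expr0 ?mul1r // IH exprS; ring.
Qed.

Lemma pev_div4 x a :
  pev x a = (x + 4) * pev x (zp_div4 a).1 + zeval (zp_div4 a).2.
Proof.
elim: a => [|c a IH] /=; first by rewrite mulr0 addr0.
rewrite {}IH zevalB zevalM.
have -> : zeval 4 = 4 by [].
ring.
Qed.

Lemma pev_evens x a : zp_is_even a -> pev x a = pev (x ^+ 2) (zp_evens a).
Proof.
have [n] := ubnP (size a); elim: n a => // n IH [|c [|d a]] //=.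
- by rewrite !mulr0.
- rewrite !ltnS => /ltnW le_an /andP[/eqb0_eq-> /IH <- //].
  by rewrite /zeval /=; ring.
Qed.

End Evaluation.

(** * Hecke algebras *)

(* The Hecke algebra over Z[X] with generators 0, ..., n - 1.  An element of
   [hecke m.+1] lists the coefficients, in [hecke m] and on the left, of the
   coset representatives [descent m j] below, 0 <= j <= m + 1; missing
   coefficients are 0. *)
Fixpoint hecke (n : nat) : Type := if n is m.+1 then seq (hecke m) else zpoly.

Definition hecke0 (n : nat) : hecke n :=
  match n with 0 => [::] | m.+1 => [::] end.

Fixpoint hecke1 (n : nat) : hecke n :=
  match n with 0 => [:: 1%coqZ] | m.+1 => [:: hecke1 m] end.

Fixpoint hadd (n : nat) : hecke n -> hecke n -> hecke n :=
  match n with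
  | 0 => zp_add
  | m.+1 => fix add a b :=
      match a, b with
      | [::], _ => b
      | _, [::] => a
      | x :: a', y :: b' => @hadd m x y :: add a' b'
      end
  end.

Fixpoint hscale (n : nat) (c : zpoly) : hecke n -> hecke n :=
  match n with 0 => zp_mul c | m.+1 => map (@hscale m c) end.

Fixpoint hzero (n : nat) : hecke n -> bool :=
  match n with 0 => zp_zero | m.+1 => all (@hzero m) end.

Definition zX : zpoly := [:: 0%coqZ; 1%coqZ].

(* Right multiplication by the generator p.  With c_j = descent m j,
   c_j p is p c_j, c_(j+1), c_(j-1) + X c_j or (p-1) c_j according to p + j. *)
Fixpoint hmul (n : nat) (p : nat) : hecke n -> hecke n :=
  match n return hecke n -> hecke n with
  | 0 => id
  | m.+1 => fun x : seq (hecke m) =>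
      let X := nth (hecke0 m) x in
      mkseq (fun j =>
        if (p + j < m)%N then @hmul m p (X j)
        else if (p + j == m)%N then X j.+1
        else if (p + j == m.+1)%N then
          @hadd m (X j.-1) (@hscale m zX (X j))
        else @hmul m p.-1 (X j)) m.+2
  end.

Definition hmuls (n : nat) (x : hecke n) (w : seq nat) : hecke n :=
  foldl (fun y p => @hmul n p y) x w.

Definition sigma (p : nat) : nat * piece := (p, Cross true).

Definition braid_letter (n : nat) (x : nat * piece) : bool :=
  (x.1 < n)%N && (if x.2 is Cross _ then true else false).

Definition braid (n : nat) (w : diagram) : bool := all (braid_letter n) w.

(** The word m, m - 1, ..., m + 1 - j: the minimal representatives of the right cosets of the
    symmetric group on m + 1 letters in the one on m + 2 letters. *)
Definition descent (m j : nat) : seq nat := rev (iota (m.+1 - j) j).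

Lemma braid_sigma n s : braid n (map sigma s) = all (fun p => p < n)%N s.
Proof. by rewrite /braid all_map; apply: eq_all => p; rewrite /= /braid_letter andbT. Qed.

Lemma braid_cat n u v : braid n (u ++ v) = braid n u && braid n v.
Proof. exact: all_cat. Qed.

Lemma braid_cons n x v : braid n (x :: v) = braid_letter n x && braid n v.
Proof. by []. Qed.

Lemma braid_leq m n w : (m <= n)%N -> braid m w -> braid n w.
Proof.
move=> le_mn; apply: sub_all => x /andP[lt_xm x_cross].
by rewrite /braid_letter x_cross (leq_trans lt_xm).
Qed.

Lemma braid_descent m j : (j <= m.+1)%N -> braid m.+1 (map sigma (descent m j)).
Proof.
move=> le_j; rewrite braid_sigma /descent all_rev; apply/allP => p.
by rewrite mem_iota => /andP[_]; rewrite subnK.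
Qed.

Lemma descentS m j : (j <= m)%N ->
  descent m j.+1 = rcons (descent m j) (m - j)%N.
Proof.
by move=> le_jm; rewrite /descent subSS /= rev_cons -subSn.
Qed.

Lemma descent_behead m j : (j <= m)%N ->
  descent m j.+1 = m :: rev (iota (m - j) j).
Proof.
move=> le_jm; rewrite /descent subSS -addn1 iotaD rev_cat /=.
by rewrite subnK.
Qed.

Lemma hadd0h n (x : hecke n) : hadd (hecke0 n) x = x.
Proof. by case: n x. Qed.

Lemma haddh0 n (x : hecke n) : hadd x (hecke0 n) = x.
Proof. by case: n x => [|n] []. Qed.

(** * Functionals on braid words that respect the Hecke relations *)

Section HeckeFunctionals.
Variables (R : comNzRingType) (h : R).
Implicit Types (g : diagram -> R) (u v w : diagram).

(* linear functionals on the Hecke algebra with generators 0, ..., n - 1 *)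
Record hecke_fun (n : nat) (g : diagram -> R) : Prop := HeckeFun {
  hf_skein : forall u v p, braid n u -> braid n v -> (p < n)%N ->
    g (u ++ (p, Cross true) :: v) - g (u ++ (p, Cross false) :: v)
      = h * g (u ++ v);
  hf_RII : forall u v p c, braid n u -> braid n v -> (p < n)%N ->
    g (u ++ [:: (p, Cross c), (p, Cross (~~ c)) & v]) = g (u ++ v);
  hf_RIII : forall u v p, braid n u -> braid n v -> (p.+1 < n)%N ->
    g (u ++ [:: sigma p, sigma p.+1, sigma p & v])
      = g (u ++ [:: sigma p.+1, sigma p, sigma p.+1 & v]);
  hf_far : forall u v p p' c c', braid n u -> braid n v ->
    (p.+1 < p')%N -> (p' < n)%N ->
    g (u ++ [:: (p, Cross c), (p', Cross c') & v])
      = g (u ++ [:: (p', Cross c'), (p, Cross c) & v])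
}.

Lemma hecke_fun_leq m n g : (m <= n)%N -> hecke_fun n g -> hecke_fun m g.
Proof.
move=> le_mn [skein RII RIII far]; have B w := @braid_leq _ _ w le_mn.
split=> *; [apply: skein | apply: RII | apply: RIII | apply: far];
  by rewrite ?B // (leq_trans _ le_mn).
Qed.

Lemma hecke_fun_catr n g w : hecke_fun n g -> braid n w ->
  hecke_fun n (fun u => g (u ++ w)).
Proof.
move=> [skein RII RIII far] Bw.
have Bvw v : braid n v -> braid n (v ++ w) by rewrite braid_cat Bw andbT.
split=> *; rewrite -!catA /=;
  [apply: skein | apply: RII | apply: RIII | apply: far] => //; exact: Bvw.
Qed.

(** The quadratic relation: the skein relation at the second letter, where the negative crossing
    cancels the first letter by move II. *)
Lemma hf_sqr n g u v p : hecke_fun n g -> braid n u -> braid n v -> (p < n)%N ->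
  g (u ++ [:: sigma p, sigma p & v]) = g (u ++ v) + h * g (u ++ sigma p :: v).
Proof.
move=> Hg Bu Bv lt_pn; apply/eqP; rewrite addrC -subr_eq.
rewrite -(hf_RII Hg true Bu Bv lt_pn) /=. 
have := @hf_skein _ _ Hg (rcons u (sigma p)) v p; rewrite !cat_rcons => -> //.
by rewrite -cats1 braid_cat Bu braid_cons /braid_letter lt_pn.
Qed.

Lemma hf_far_word n g s u v p : hecke_fun n g -> braid n u -> braid n v ->
  (p < n)%N -> all (fun p' => (p' < n) && ((p.+1 < p') || (p'.+1 < p)))%N s ->
  g (u ++ map sigma s ++ sigma p :: v) = g (u ++ sigma p :: map sigma s ++ v).
Proof.
move=> Hg Bu Bv lt_pn; elim: s u Bu => //= p' s IH u Bu /andP[/andP[lt_n far] all_s].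
have Bs: braid n (map sigma s).
  by rewrite braid_sigma; apply: sub_all all_s => ? /andP[].
rewrite -cat_rcons IH ?all_s //; last first.
  by rewrite -cats1 braid_cat Bu braid_cons /braid_letter lt_n.
rewrite cat_rcons; case/orP: far => far; [symmetry|];
  by apply: (hf_far Hg) => //; rewrite braid_cat Bs.
Qed.

(** The bound on p + j makes both p and p - 1 letters of the descent. The generator p commutes with
    the letters below p - 1, the braid relation carries it across p, p - 1 and lowers it to p - 1,
    and this commutes with the letters above p. *)
Lemma hf_descent n g u v p j : hecke_fun n.+1 g -> braid n.+1 u ->
  braid n.+1 v -> (p <= n)%N -> (j <= n.+1)%N -> (n.+1 < p + j)%N ->
  g (u ++ map sigma (descent n j) ++ sigma p :: v)
    = g (u ++ sigma p.-1 :: map sigma (descent n j) ++ v).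
Proof.
case: p => [|p] Hg Bu Bv le_pn le_jn lt_npj; first by lia.
(* From here on the generator is [p.+1]; [hi] and [lo] are the letters of the descent above [p.+1]
   and below [p]. *)
pose lo := rev (iota (n.+1 - j) (p + j - n.+1)).
pose hi := rev (iota p.+2 (n - p.+1)).
have Blo: all (fun p' => (p'.+1 < p.+1) && (p' < n.+1))%N lo.
  rewrite /lo all_rev; apply/allP => i; rewrite mem_iota; lia.
have Bhi: all (fun p' => (p.+1 < p') && (p' < n.+1))%N hi.
  rewrite /hi all_rev; apply/allP => i; rewrite mem_iota; lia.
have -> : descent n j = hi ++ [:: p.+1, p & lo].
  rewrite /descent /hi /lo.
  have E : j = ((p + j - n.+1) + (2 + (n - p.+1)))%N by lia.
  rewrite [X in rev (iota _ X) = _]E !iotaD !rev_cat -catA.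
  have -> : (n.+1 - j + (p + j - n.+1) = p)%N by lia.
  by rewrite addn2.
have B1 : braid n.+1 (map sigma hi).
  by rewrite braid_sigma; apply: sub_all Bhi => ? /andP[].
have B2 : braid n.+1 (map sigma lo).
  by rewrite braid_sigma; apply: sub_all Blo => ? /andP[].
have lt_p : (p < n.+1)%N by lia.
have Bp : braid_letter n.+1 (sigma p) by rewrite /braid_letter lt_p.
have Bp1 : braid_letter n.+1 (sigma p.+1) by rewrite /braid_letter andbT.
rewrite map_cat -!catA /= -(hf_far_word Hg) //; first last.
- by apply: sub_all Bhi => i /andP[lt_i ->]; rewrite lt_i.
- by rewrite !braid_cons Bp Bp1 braid_cat B2 Bv.
have far_lo := hf_far_word (s := lo) (p := p.+1) Hg
  (u := u ++ map sigma hi ++ [:: sigma p.+1; sigma p]) (v := v).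
rewrite -!catA /= in far_lo; rewrite {}far_lo //.
- by rewrite !catA -(hf_RIII Hg) // braid_cat ?Bu ?B2.
- by rewrite !braid_cat Bu B1 /= Bp Bp1.
by apply: sub_all Blo => i /andP[-> ->]; rewrite orbT.
Qed.

(* the value of a functional at an element, expanded in the basis of products
   of the words [descent] *)
Fixpoint hval (n : nat) : hecke n -> (diagram -> R) -> R :=
  match n return hecke n -> (diagram -> R) -> R with
  | 0 => fun a g => pev h a * g [::]
  | m.+1 => fun (x : seq (hecke m)) g =>
      \sum_(0 <= j < m.+2)
        hval (nth (hecke0 m) x j) (fun u => g (u ++ map sigma (descent m j)))
  end.

Lemma eq_hval n (x : hecke n) g g' :
  (forall u, braid n u -> g u = g' u) -> hval x g = hval x g'.
Proof.
elim: n x g g' => [|m IH] x g g' eq_g /=; first by rewrite eq_g.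
apply: eq_big_nat => j /andP[_ lt_j]; apply: IH => u Bu; apply: eq_g.
by rewrite braid_cat (braid_leq _ Bu) // braid_descent.
Qed.

Lemma hval_hecke0 n g : hval (hecke0 n) g = 0.
Proof.
elim: n g => [|m IH] g /=; first by rewrite mul0r.
by rewrite big1 // => j _; rewrite nth_nil IH.
Qed.

Lemma hval_hecke1 n g : hval (hecke1 n) g = g [::].
Proof.
elim: n g => [|m IH] g /=; first by rewrite mulr0 addr0 mul1r.
rewrite big_nat_recl //= IH big1_seq ?addr0 // => j _.
by rewrite nth_nil hval_hecke0.
Qed.

Lemma hval_add n (x y : hecke n) g : hval (hadd x y) g = hval x g + hval y g.
Proof.
elim: n x y g => [|m IH] x y g /=; first by rewrite pev_add mulrDl.
rewrite -big_split /=; apply: eq_bigr => j _.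
rewrite -IH; congr (hval _ _).
by elim: x y j => [|a x IHx] [|b y] [|j] //=;
  rewrite ?nth_nil ?hadd0h ?haddh0.
Qed.

Lemma hval_scale n c (x : hecke n) g : hval (hscale c x) g = pev h c * hval x g.
Proof.
elim: n x g => [|m IH] x g /=; first by rewrite pev_mul mulrA.
rewrite big_distrr; apply: eq_bigr => j _ /=.
have [lt_j|le_j] := ltnP j (size x); first by rewrite (nth_map (hecke0 m)) ?IH.
by rewrite !nth_default ?size_map // hval_hecke0 mulr0.
Qed.

Lemma hval_zero n (x : hecke n) g : hzero x -> hval x g = 0.
Proof.
elim: n x g => [|m IH] x g /=; first by move/pev_zero->; rewrite mul0r.
move=> /(all_nthP (hecke0 m)) x0; apply: big1 => j _.
have [lt_j|le_j] := ltnP j (size x); first by rewrite IH ?x0.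
by rewrite nth_default // hval_hecke0.
Qed.

Lemma pev_zX : pev h zX = h.
Proof. by rewrite /= zeval0 zeval1; ring. Qed.

Lemma hval_addf n (x : hecke n) g1 g2 :
  hval x (fun u => g1 u + g2 u) = hval x g1 + hval x g2.
Proof.
elim: n x g1 g2 => [|m IH] x g1 g2 /=; first by rewrite mulrDr.
by rewrite -big_split; apply: eq_bigr => j _; rewrite IH.
Qed.

Lemma hval_scalef n (x : hecke n) a g :
  hval x (fun u => a * g u) = a * hval x g.
Proof.
elim: n x g => [|m IH] x g /=; first by rewrite mulrCA.
by rewrite big_distrr; apply: eq_bigr => j _; rewrite IH.
Qed.

(** With d = m - p, the generator p commutes with the representatives of index below d, is lowered
    by [hf_descent] past those of index above d + 1, and mixes only the indices d and d + 1. *)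
Lemma hval_mul n p (x : hecke n) g : hecke_fun n g -> (p < n)%N ->
  hval (hmul p x) g = hval x (fun u => g (u ++ [:: sigma p])).
Proof.
elim: n p x g => // m IH p x g Hg lt_pm.
rewrite [LHS]/= [RHS]/=.
have Hd j : (j <= m.+1)%N ->
    hecke_fun m (fun u => g (u ++ map sigma (descent m j))).
  by move=> le_j; apply: hecke_fun_leq (hecke_fun_catr Hg (braid_descent le_j)).
have Bm u := @braid_leq _ _ u (leqnSn m).
pose A i j := hval (nth (hecke0 m) x i)
  (fun u => g (u ++ map sigma (descent m j))).
pose d := (m - p)%N.
have sub_d : (m - d = p)%N by lia.
have Ed : map sigma (descent m d.+1) = map sigma (descent m d) ++ [:: sigma p].
  by rewrite descentS ?leq_subr // map_rcons -cats1 sub_d.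
rewrite !(@big_cat_nat _ _ _ d 0 m.+2) //=; try lia.
congr (_ + _).
  apply: eq_big_nat => j lt_j; rewrite nth_mkseq; last lia.
  rewrite ifT; last lia.
  rewrite IH; [|by apply: Hd; lia|lia].
  apply: eq_hval => u /Bm Bu; rewrite -!catA /=.
  rewrite (hf_far_word Hg) ?cats0 //.
  rewrite /descent all_rev; apply/allP => i; rewrite mem_iota; lia.
have split2 (F : nat -> R) : \sum_(d <= j < m.+2) F j
    = F d + F d.+1 + \sum_(d.+2 <= j < m.+2) F j.
  by rewrite -addrA -!big_ltn //; lia.
rewrite !split2; congr (_ + _); last first.
  apply: eq_big_nat => j lt_j; rewrite nth_mkseq; last lia.
  rewrite !ifF; try lia.
  rewrite IH; [|by apply: Hd; lia|lia].
  apply: eq_hval => u /Bm Bu; rewrite -!catA /=.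
  rewrite (hf_descent Hg) ?cats0 //; lia.
have Ep : (p + d = m)%N by lia.
rewrite !nth_mkseq ?addnS ?Ep ?ltnn ?eqxx; try lia.
rewrite ltnNge leqnSn /= gtn_eqF // hval_add hval_scale pev_zX /=.
rewrite -/(A d.+1 d) -/(A d d.+1) -/(A d.+1 d.+1).
have -> : hval (nth (hecke0 m) x d)
    (fun u => g ((u ++ map sigma (descent m d)) ++ [:: sigma p])) = A d d.+1.
  by apply: eq_hval => u _; rewrite Ed catA.
(* [descent m d.+1] already ends in p, so multiplying by p squares this letter and the quadratic
   relation gives two terms. *)
have -> : hval (nth (hecke0 m) x d.+1)
    (fun u => g ((u ++ map sigma (descent m d.+1)) ++ [:: sigma p]))
    = A d.+1 d + h * A d.+1 d.+1.
  rewrite -hval_scalef -hval_addf; apply: eq_hval => u /Bm Bu.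
  rewrite Ed -!catA /= [u ++ _]catA (hf_sqr Hg) ?cats0 -?catA // braid_cat Bu.
  by rewrite braid_descent //; lia.
ring.
Qed.
End HeckeFunctionals.

(** * Closed braids *)

Lemma run_cat s s' u v : run s u = Some s' -> run s (u ++ v) = run s' v.
Proof.
by elim: u s => [s [->]|x u IH s] //=; case: (step s x) => //= r /IH.
Qed.

Lemma run_cons s s' x w : step s x = Some s' -> run s (x :: w) = run s' w.
Proof. by move=> /= ->. Qed.

Definition closure_cups (n : nat) : diagram :=
  [seq (i, Cup true) | i <- iota 0 n].
Definition closure_caps (n : nat) : diagram :=
  [seq (i, Cap) | i <- rev (iota 0 n)].
Lemma closed_braidE n w :
  closed_braid n w = closure_cups n ++ w ++ closure_caps n.
Proof. by []. Qed.

Definition closure_level (n : nat) : seq bool := nseq n true ++ nseq n false.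

Lemma closure_cupsS n :
  closure_cups n.+1 = closure_cups n ++ [:: (n, Cup true)].
Proof. by rewrite /closure_cups -addn1 iotaD map_cat. Qed.

Lemma closure_capsS n : closure_caps n.+1 = (n, Cap) :: closure_caps n.
Proof. by rewrite /closure_caps -addn1 iotaD rev_cat. Qed.

Lemma nseqSr (T : Type) n (x : T) s : nseq n.+1 x ++ s = nseq n x ++ x :: s.
Proof. by elim: n => //= n <-. Qed.

Lemma step_cup n :
  step (closure_level n) (n, Cup true) = Some (closure_level n.+1).
Proof.
rewrite /step /closure_level size_cat !size_nseq leq_addr.
by rewrite take_size_cat ?drop_size_cat ?size_nseq // -nseqSr.
Qed.

Lemma step_cap n : step (closure_level n.+1) (n, Cap) = Some (closure_level n).
Proof.
rewrite /step /closure_level nseqSr.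
by rewrite drop_size_cat ?take_size_cat ?size_nseq.
Qed.

Lemma run_closure_cups n : run [::] (closure_cups n) = Some (closure_level n).
Proof.
by elim: n => // n IH; rewrite closure_cupsS (run_cat _ IH) (run_cons _ (step_cup n)).
Qed.

Lemma run_closure_caps n : run (closure_level n) (closure_caps n) = Some [::].
Proof.
by elim: n => // n IH; rewrite closure_capsS (run_cons _ (step_cap n)).
Qed.

Lemma closure_level_split n p : (p < n)%N ->
  closure_level n.+1
    = nseq p true ++ [:: true, true & nseq (n - p.+1) true ++ nseq n.+1 false].
Proof.
move=> lt_pn; rewrite -!nseqSr /closure_level catA -nseqD.
by congr (nseq _ _ ++ _); lia.
Qed.

Lemma run_braid n w : braid n w ->
  run (closure_level n.+1) w = Some (closure_level n.+1).
Proof.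
elim: w => // -[p [?| |c]] w IH; rewrite braid_cons /braid_letter /= ?andbF //.
rewrite andbT => /andP[lt_pn Bw]; rewrite (closure_level_split lt_pn).
rewrite drop_size_cat ?take_size_cat ?size_nseq //=.
by rewrite -closure_level_split ?IH.
Qed.

Lemma is_link_closed_braid n w : braid n w -> is_link (closed_braid n.+1 w).
Proof.
move=> Bw; rewrite /is_link closed_braidE.
by rewrite (run_cat _ (run_closure_cups _)) (run_cat _ (run_braid Bw)) run_closure_caps.
Qed.

(* the closure of [u v w], the last strand being closed just around [v] *)
Definition stab (n : nat) (u v w : diagram) : diagram :=
  closure_cups n.+1 ++ u ++ (n.+1, Cup true) :: v ++
  (n.+1, Cap) :: w ++ closure_caps n.+1.

Lemma is_link_stab n u v w : braid n u -> braid n.+1 v -> braid n w ->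
  is_link (stab n u v w).
Proof.
move=> Bu Bv Bw; rewrite /is_link /stab (run_cat _ (run_closure_cups _)).
rewrite (run_cat _ (run_braid Bu)) (run_cons _ (step_cup _)).
rewrite (run_cat _ (run_braid Bv)) (run_cons _ (step_cap _)).
by rewrite (run_cat _ (run_braid Bw)) run_closure_caps.
Qed.

Lemma move_far n p c (x : piece) : (p.+1 < n)%N ->
  local_move [:: (n, x); (p, Cross c)] [:: (p, Cross c); (n, x)].
Proof.
move=> lt_pn; rewrite -[in X in local_move _ X](@subnK 2 n); last by lia.
by apply: move_exchange; rewrite addn2.
Qed.

(** * Hecke relations and Markov moves for closed braids *)

Section Homfly.
Variables (H : diagram -> Qqt) (HH : framed_homfly H).

(** All braid strands point upwards, so the skein relation is its parallel case; the other relations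
    are moves II and III and exchanges of height, performed between the cups and the caps. *)
Lemma homfly_hecke_fun n : hecke_fun z n (fun w => H (closed_braid n.+1 w)).
Proof.
have link u v w : braid n u -> braid n v -> braid n w ->
    is_link ((closure_cups n.+1 ++ u) ++ w ++ v ++ closure_caps n.+1).
  move=> Bu Bv Bw; rewrite -!catA.
  have /is_link_closed_braid : braid n (u ++ w ++ v).
    by rewrite !braid_cat Bu Bv Bw.
  by rewrite closed_braidE -!catA.
have inv u v w w' : local_move w w' -> braid n u -> braid n v ->
    braid n w -> braid n w' ->
    H (closed_braid n.+1 (u ++ w ++ v)) = H (closed_braid n.+1 (u ++ w' ++ v)).
  move=> mv Bu Bv Bw Bw'; rewrite !closed_braidE -!catA.
  rewrite [in LHS]catA [in RHS]catA.
  by apply: (homfly_invariant HH mv); apply: link.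
split.
- move=> u v p Bu Bv lt_pn; rewrite !closed_braidE -!catA.
  rewrite !(catA (closure_cups _)).
  apply: (homfly_skein HH); last first.
    have := @link u v [:: sigma p] Bu Bv.
    by rewrite braid_cons /braid_letter lt_pn; apply.
  have := @conway_parallel (closure_cups n.+1 ++ u) (v ++ closure_caps n.+1)
    (nseq p true) true (nseq (n - p.+1) true ++ nseq n.+1 false).
  rewrite size_nseq -closure_level_split //; apply.
  by rewrite (run_cat _ (run_closure_cups _)) run_braid.
- move=> u v p c Bu Bv lt_pn; rewrite -[_ :: _ :: _]/([:: _; _] ++ v).
  rewrite (inv _ _ _ [::]) //; first exact: move_RII.
  by rewrite /braid /= /braid_letter lt_pn.
- move=> u v p Bu Bv lt_pn.
  rewrite -[[:: sigma p, _, _ & _]]/([:: _; _; _] ++ v).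
  rewrite -[[:: sigma p.+1, _, _ & _]]/([:: _; _; _] ++ v).
  apply: inv => //; first exact: move_RIII.
  - by rewrite /braid /= /braid_letter /= lt_pn ltnW.
  - by rewrite /braid /= /braid_letter /= lt_pn ltnW.
- move=> u v p p' c c' Bu Bv lt_pp' lt_p'n.
  rewrite -[[:: (p, _), _ & _]]/([:: _; _] ++ v).
  rewrite -[[:: (p', _), _ & _]]/([:: _; _] ++ v).
  have lt_pn : (p < n)%N by lia.
  symmetry; apply: inv => //; rewrite /braid /= /braid_letter /= ?lt_pn ?lt_p'n //.
  exact: move_far.
Qed.

Lemma homfly_far D D' n p c x : (p.+1 < n)%N ->
  is_link (D ++ [:: (n, x), (p, Cross c) & D']) ->
  is_link (D ++ [:: (p, Cross c), (n, x) & D']) ->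
  H (D ++ [:: (n, x), (p, Cross c) & D'])
    = H (D ++ [:: (p, Cross c), (n, x) & D']).
Proof. by move=> lt_pn; apply: (homfly_invariant HH (move_far c x lt_pn)). Qed.

(** The letters of [u] and [w] do not touch the last strand: its cup rises past [u] and its cap
    descends past [w], one exchange of heights at a time. *)
Lemma homfly_stab n u v w : braid n u -> braid n.+1 v -> braid n w ->
  H (closed_braid n.+2 (u ++ v ++ w)) = H (stab n u v w).
Proof.
move=> Bu Bv Bw.
have catD u' v' D : closure_cups n.+1 ++ u' ++ (n.+1, Cup true) :: v' ++ D
    = (closure_cups n.+1 ++ rcons u' (n.+1, Cup true) ++ v') ++ D.
  by rewrite -!catA cat_rcons.
have slide_cup u' x v' w' : braid n u' -> braid_letter n x -> braid n.+1 v' ->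
    braid n w' -> H (stab n u' (x :: v') w') = H (stab n (rcons u' x) v' w').
  case: x => p [?| |c] Bu' Bx Bv' Bw'; rewrite /braid_letter /= ?andbF // in Bx.
  have lt_pn : (p < n)%N by rewrite andbT in Bx.
  have E1 : stab n u' ((p, Cross c) :: v') w' = (closure_cups n.+1 ++ u') ++
      [:: (n.+1, Cup true), (p, Cross c) & v' ++ (n.+1, Cap) :: w' ++ closure_caps n.+1].
    by rewrite -catA.
  have E2 : stab n (rcons u' (p, Cross c)) v' w' = (closure_cups n.+1 ++ u') ++
      [:: (p, Cross c), (n.+1, Cup true) & v' ++ (n.+1, Cap) :: w' ++ closure_caps n.+1].
    by rewrite /stab cat_rcons -catA.
  rewrite E1 E2; apply: homfly_far => //.
    rewrite -E1; apply: is_link_stab => //.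
    by rewrite braid_cons Bv' /braid_letter /= ltnS ltnW.
  rewrite -E2; apply: is_link_stab => //.
  by rewrite -cats1 braid_cat Bu' braid_cons /braid_letter lt_pn.
have slide_cap u' x v' w' : braid n u' -> braid_letter n x -> braid n.+1 v' ->
    braid n w' -> H (stab n u' (rcons v' x) w') = H (stab n u' v' (x :: w')).
  case: x => p [?| |c] Bu' Bx Bv' Bw'; rewrite /braid_letter /= ?andbF // in Bx.
  have lt_pn : (p < n)%N by rewrite andbT in Bx.
  pose D := closure_cups n.+1 ++ rcons u' (n.+1, Cup true) ++ v'.
  have E1 : stab n u' (rcons v' (p, Cross c)) w' = D ++
      [:: (p, Cross c), (n.+1, Cap) & w' ++ closure_caps n.+1].
    by rewrite /stab cat_rcons catD.
  have E2 : stab n u' v' ((p, Cross c) :: w') = D ++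
      [:: (n.+1, Cap), (p, Cross c) & w' ++ closure_caps n.+1].
    by rewrite /stab catD.
  rewrite E1 E2; symmetry; apply: homfly_far => //.
    rewrite -E2; apply: is_link_stab => //.
    by rewrite braid_cons Bw' /braid_letter /= lt_pn.
  rewrite -E1; apply: is_link_stab => //.
  by rewrite -cats1 braid_cat Bv' braid_cons /braid_letter /= ltnS ltnW.
have Bn w' : braid n w' -> braid n.+1 w' by apply: braid_leq.
have -> : H (closed_braid n.+2 (u ++ v ++ w))
           = H (stab n [::] (u ++ v ++ w) [::]).
  congr (H _); rewrite closed_braidE closure_cupsS closure_capsS.
  by rewrite /stab -!catA.
have slide_cups u' v' : braid n u' -> braid n u -> braid n.+1 v' ->
    H (stab n u' (u ++ v') [::]) = H (stab n (u' ++ u) v' [::]).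
  move=> Bu' + Bv'; elim: u u' Bu' {Bu} => [|x u IH] u' Bu'; first by rewrite cats0.
  rewrite braid_cons => /andP[Bx Bu].
  rewrite cat_cons slide_cup // ?braid_cat ?Bv' ?Bn ?Bu //; rewrite IH ?cat_rcons //.
  by rewrite -cats1 braid_cat Bu' braid_cons Bx.
have slide_caps w' : braid n w -> braid n w' ->
    H (stab n u (v ++ w) w') = H (stab n u v (w ++ w')).
  elim/last_ind: w w' {Bw} => [|w x IH] w'; first by rewrite cats0.
  rewrite -cats1 braid_cat braid_cons andbT => /andP[Bw Bx] Bw'.
  rewrite catA cats1 slide_cap ?braid_cat ?Bv ?Bn //; rewrite IH ?braid_cons ?Bx //.
  by rewrite -catA.
by rewrite slide_cups ?braid_cat ?Bv ?Bn // slide_caps // cats0.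
Qed.

Definition unknot : Qqt := (t - t^-1) / (q - q^-1).

Lemma homfly_closure0 : H (closed_braid 1 [::]) = unknot.
Proof.
have := homfly_unknot HH (D := [::]) (D' := [::]) (i := 0) (o := true) erefl.
by rewrite (homfly_empty HH) mulr1.
Qed.

(** With nothing between them, the last cup and cap form a disjoint circle. *)
Lemma homfly_destab0 n u : braid n u ->
  H (closed_braid n.+2 u) = unknot * H (closed_braid n.+1 u).
Proof.
move=> Bu.
have -> : H (closed_braid n.+2 u) = H (stab n u [::] [::]).
  by rewrite -homfly_stab //= cats0.
have := is_link_stab Bu (isT : braid _ [::]) (isT : braid _ [::]).
rewrite /stab catA; rewrite -[(n.+1, _) :: _]/([:: _; _] ++ closure_caps n.+1).
by move=> L; rewrite (homfly_unknot HH) // closed_braidE catA.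
Qed.

(** Once the last strand is closed just around its only crossing, that crossing with its cup and cap
    is literally a positive right kink. *)
Lemma homfly_destab1 n u w : braid n u -> braid n w ->
  H (closed_braid n.+2 (u ++ sigma n :: w)) = t * H (closed_braid n.+1 (u ++ w)).
Proof.
move=> Bu Bw.
have Bs : braid n.+1 [:: sigma n] by rewrite /braid /= /braid_letter /= ltnSn.
rewrite -[sigma n :: w]/([:: sigma n] ++ w) homfly_stab //.
have := is_link_stab Bu Bs Bw.
rewrite /stab catA -[(n.+1, _) :: _]/(kink true n true true ++ w ++ closure_caps n.+1).
by move=> L; rewrite (homfly_kink HH) // closed_braidE -!catA.
Qed.

End Homfly.

(** * The Markov trace *)

Lemma hval_muls (R : comNzRingType) (h : R) n (x : hecke n) s g :
  hecke_fun h n g -> all (fun p => p < n)%N s ->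
  hval h (hmuls x s) g = hval h x (fun u => g (u ++ map sigma s)).
Proof.
move=> Hg; elim: s x => [|p s IH] x /=.
  by move=> _; apply: eq_hval => u _; rewrite cats0.
move=> /andP[lt_pn Bs]; rewrite IH // hval_mul //.
  by apply: eq_hval => u _; rewrite -catA.
by apply: hecke_fun_catr Hg _; rewrite braid_sigma.
Qed.

(* The Markov trace divided by unknot^(n+1), as a polynomial in t / unknot. *)
Fixpoint htrace (n : nat) : hecke n -> seq zpoly :=
  match n return hecke n -> seq zpoly with
  | 0 => fun a => [:: a]
  | m.+1 => fun x : seq (hecke m) =>
      let X := nth (hecke0 m) x in
      @hadd 1 (@htrace m (X 0))
        ([::] :: foldr (@hadd 1) [::]
           [seq @htrace m (hmuls (X j.+1) (rev (iota (m - j) j)))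
           | j <- iota 0 m.+1])
  end.

Section TraceValue.
Variables (R : comNzRingType) (h y : R).

Fixpoint teval (o : seq zpoly) : R :=
  if o is a :: o' then pev h a + y * teval o' else 0.

(** [hecke 1] is [seq zpoly], so [@hadd 1] also adds polynomials in y; prefixing [[::]] to such a
    list multiplies it by y. *)
Lemma teval_add (o o' : hecke 1) :
  teval (@hadd 1 o o') = teval o + teval o'.
Proof.
elim: o o' => [|a o IH] [|b o'] /=; rewrite ?add0r ?addr0 //.
by rewrite pev_add IH; ring.
Qed.

Lemma teval_foldr (s : seq (seq zpoly)) :
  teval (foldr (@hadd 1) [::] s) = \sum_(o <- s) teval o.
Proof.
by elim: s => [|o s IH] /=; rewrite ?big_nil // big_cons teval_add IH.
Qed.

Lemma teval_htrace m (x : hecke m.+1) :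
  teval (htrace x) = teval (htrace (nth (hecke0 m) x 0)) + y *
    \sum_(0 <= j < m.+1)
      teval (htrace (hmuls (nth (hecke0 m) x j.+1) (rev (iota (m - j) j)))).
Proof.
pose f j := htrace (hmuls (nth (hecke0 m) x j.+1) (rev (iota (m - j) j))).
have -> : htrace x = @hadd 1 (htrace (nth (hecke0 m) x 0))
    ([::] :: foldr (@hadd 1) [::] (map f (iota 0 m.+1))) by [].
rewrite teval_add [teval (_ :: _)]/(teval _) -/teval add0r teval_foldr big_map.
by rewrite /index_iota subn0.
Qed.
End TraceValue.

Lemma mul_exprS_div (K : fieldType) (u v a : K) k : u != 0 ->
  u ^+ k.+1 * (v / u * a) = v * (u ^+ k * a).
Proof. by move=> u0; rewrite exprS; field. Qed.

Section HomflyTrace.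
Variables (H : diagram -> Qqt) (HH : framed_homfly H).
Hypothesis unknot_neq0 : unknot != 0.

(** Induction on the number of strands. The representative of index 0 leaves the last strand free
    and gives a factor [unknot]; any other one contains the top generator once, as its first letter,
    which gives a factor t, and its remaining letters are multiplied into the coefficient. *)
Lemma hval_homfly n (x : hecke n) :
  hval z x (fun u => H (closed_braid n.+1 u))
    = unknot ^+ n.+1 * teval z (t / unknot) (htrace x).
Proof.
elim: n x => [|m IH] x.
  by rewrite /= (homfly_closure0 HH) mulr0 addr0 mulrC.
rewrite [LHS]/= teval_htrace mulrDr.
rewrite big_nat_recl //; congr (_ + _).
  rewrite exprS -mulrA -IH -hval_scalef; apply: eq_hval => u Bu /=.
  by rewrite cats0 homfly_destab0.
rewrite mul_exprS_div //.
rewrite !big_distrr /=.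
apply: eq_big_nat => j /andP[_ lt_j].
have Bj : all (fun p => p < m)%N (rev (iota (m - j) j)).
  rewrite all_rev; apply/allP => p; rewrite mem_iota; lia.
rewrite -IH hval_muls -?hval_scalef //; last exact: homfly_hecke_fun.
apply: eq_hval => u Bu.
by rewrite descent_behead //= homfly_destab1 // braid_sigma.
Qed.
End HomflyTrace.

(** * Nonvanishing of the denominators, and the moduli as polynomials in z^2 *)

Lemma q_neq0 : q != 0.
Proof. by rewrite /q tofrac_eq0 polyC_eq0 polyX_eq0. Qed.

Lemma t_neq0 : t != 0.
Proof. by rewrite /t tofrac_eq0 polyX_eq0. Qed.

Lemma q_exp_neq1 n : (0 < n)%N -> q ^+ n != 1.
Proof.
move=> n_gt0; rewrite /q -tofracXn -tofrac1 tofrac_eq -polyC_exp -polyC1.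
rewrite (inj_eq polyC_inj); apply/eqP => /(congr1 (fun p : {poly rat} => size p)).
by rewrite size_polyXn size_poly1 => -[]; lia.
Qed.

Lemma t_exp_neq1 n : (0 < n)%N -> t ^+ n != 1.
Proof.
move=> n_gt0; rewrite /t -tofracXn -tofrac1 tofrac_eq.
apply/eqP => /(congr1 (fun p : {poly {poly rat}} => size p)).
by rewrite size_polyXn size_poly1 => -[]; lia.
Qed.

Lemma qbr_neq0 n : (0 < n)%N -> qbr n != 0.
Proof.
move=> n_gt0; have /= := @q_exp_neq1 (n + n) ltac:(lia).
apply: contra; rewrite /qbr subr_eq0 => /eqP E.
by rewrite exprD {1}E mulVf // expf_neq0 ?q_neq0.
Qed.

Lemma qbr1E : qbr 1 = z. Proof. by rewrite /qbr !expr1. Qed.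

Lemma z_neq0 : z != 0.
Proof. by rewrite -qbr1E qbr_neq0. Qed.

Lemma unknot_neq0 : unknot != 0.
Proof.
rewrite /unknot -/z mulf_neq0 //; last by rewrite invr_eq0 z_neq0.
apply: contra (@t_exp_neq1 2 isT); rewrite subr_eq0 => /eqP E.
by rewrite expr2 {1}E mulVf ?t_neq0.
Qed.

(** The quotient is x + x^-1. Through this identity both moduli become products of powers of z and
    z^2 + 4, the shape tested by [zp_dvd]. *)
Lemma quantum2_sqr (K : fieldType) (x : K) : x != 0 -> x - x^-1 != 0 ->
  ((x ^+ 2 - x ^- 2) / (x - x^-1)) ^+ 2 = (x - x^-1) ^+ 2 + 4.
Proof.
move=> x0 y0; have -> : x ^+ 2 - x ^- 2 = (x - x^-1) * (x + x^-1) by field.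
by rewrite mulrAC divff // mul1r; field.
Qed.

Lemma qcurl2_sqr : qcurl 2 ^+ 2 = z ^+ 2 + 4.
Proof. by rewrite /qcurl qbr1E quantum2_sqr ?q_neq0 ?z_neq0. Qed.

Lemma qbr2_sqr : qbr 2 ^+ 2 = z ^+ 2 * (z ^+ 2 + 4).
Proof.
by rewrite -qcurl2_sqr -exprMn /qcurl qbr1E mulrC divfK ?z_neq0.
Qed.

(** * Integrality *)

Lemma Zz2t1 : in_Zz2t 1. Proof. exact: subring_gen1. Qed.

Lemma Zz2tB x y : in_Zz2t x -> in_Zz2t y -> in_Zz2t (x - y).
Proof. exact: subring_genB. Qed.

Lemma Zz2tM x y : in_Zz2t x -> in_Zz2t y -> in_Zz2t (x * y).
Proof. exact: subring_genM. Qed.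

Lemma Zz2t0 : in_Zz2t 0.
Proof. by rewrite -(subrr 1); apply: Zz2tB Zz2t1 Zz2t1. Qed.

Lemma Zz2tN x : in_Zz2t x -> in_Zz2t (- x).
Proof. by rewrite -sub0r; apply: Zz2tB Zz2t0. Qed.

Lemma Zz2tD x y : in_Zz2t x -> in_Zz2t y -> in_Zz2t (x + y).
Proof. by move=> Zx Zy; rewrite -(opprK y); apply/Zz2tB/Zz2tN. Qed.

Lemma Zz2tX x n : in_Zz2t x -> in_Zz2t (x ^+ n).
Proof.
move=> Zx; elim: n => [|n IH]; first exact: Zz2t1.
by rewrite exprS; apply: Zz2tM.
Qed.

Lemma Zz2t_nat n : in_Zz2t n%:R.
Proof.
elim: n => [|n IH]; first exact: Zz2t0.
by rewrite -natr1; apply: Zz2tD Zz2t1.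
Qed.

Lemma Zz2t_zeval c : in_Zz2t (zeval Qqt c).
Proof.
rewrite /zeval; case: (int_of_Z c) => n; first exact: Zz2t_nat.
by rewrite NegzE mulrNz; apply/Zz2tN/Zz2t_nat.
Qed.

Lemma Zz2t_sqr : in_Zz2t (z ^+ 2).
Proof. by apply: subring_gen_in; apply: Or31. Qed.

Lemma Zz2t_t : in_Zz2t t.
Proof. by apply: subring_gen_in; apply: Or32. Qed.

Lemma Zz2t_tV : in_Zz2t t^-1.
Proof. by apply: subring_gen_in; apply: Or33. Qed.

Lemma Zz2t_pev a : in_Zz2t (pev (z ^+ 2) a).
Proof.
elim: a => [|c a IH]; first exact: Zz2t0.
by apply: Zz2tD (Zz2t_zeval c) _; apply: Zz2tM Zz2t_sqr IH.
Qed.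

Lemma Zz2t_even a : zp_is_even a -> in_Zz2t (pev z a).
Proof. by move/pev_evens->; apply: Zz2t_pev. Qed.

Lemma pev_dvd4 (R : comNzRingType) (x : R) b a : zp_dvd4 b a ->
  exists a', pev x a = (x + 4) ^+ b * pev x a'.
Proof.
elim: b a => [|b IH] a /=; first by exists a; rewrite mul1r.
case/andP=> /eqb0_eq r0 /IH[a' Ea']; exists a'.
by rewrite (pev_div4 x a) Ea' r0 zeval0 exprS addr0 mulrA.
Qed.

Lemma pev_dvd k b a : zp_dvd k b a ->
  exists2 Q, in_Zz2t Q & pev z a = z ^+ k * (z ^+ 2 + 4) ^+ b * Q.
Proof.
case/and3P=> low0 even_hi /(pev_dvd4 (z ^+ 2))[a' Ea'].
exists (pev (z ^+ 2) a'); first exact: Zz2t_pev.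
rewrite -{1}(cat_take_drop k a) pev_cat (pev_zero _ low0) add0r.
(* [take k a] has length k only in the first case; in the second one the whole polynomial
   vanishes. *)
have [lt_k|le_k] := ltnP k (size a).
  by rewrite size_takel ?(ltnW lt_k) // (pev_evens _ even_hi) Ea' mulrA.
rewrite (drop_oversize le_k) /= in Ea' *.
by rewrite -mulrA -Ea' !mulr0.
Qed.

(* The coefficient of t^i unknot^(k - i) must absorb the denominator z^(k - i)
   of unknot^(k - i) = ((t - t^-1) / z)^(k - i) besides z^s (z^2 + 4)^b. *)
Fixpoint trace_dvd (s b k : nat) (o : seq zpoly) : bool :=
  if o is a :: o' then
    (if k is k'.+1 then zp_dvd (s + k) b a && trace_dvd s b k' o' else false)
  else true.

Lemma mul_shuffle (R : comNzRingType) (u s k m x : R) :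
  u * (s * k * m * x) = s * m * (u * k * x).
Proof. ring. Qed.

(** Since [unknot] times z is t - t^-1, the extra power of z required of each coefficient turns the
    matching power of [unknot] into a power of t - t^-1, which is integral. Passing to the next
    coefficient trades one factor [unknot] for t. *)
Lemma trace_dvdP s b k o : trace_dvd s b k o ->
  exists2 Q, in_Zz2t Q &
    unknot ^+ k * teval z (t / unknot) o = z ^+ s * (z ^+ 2 + 4) ^+ b * Q.
Proof.
have z0 := z_neq0; have u0 := unknot_neq0.
elim: o k => [|a o IH] [|k] //=; try by exists 0; [exact: Zz2t0|rewrite !mulr0].
case/andP=> /pev_dvd[Q ZQ Ea] /IH[Q' ZQ' Eo].
exists ((t - t^-1) ^+ k.+1 * Q + t * Q').
  apply: Zz2tD; apply: Zz2tM => //; last exact: Zz2t_t.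
  by apply: Zz2tX; apply: Zz2tB Zz2t_t Zz2t_tV.
have -> : t - t^-1 = unknot * z by rewrite /unknot -/z divfK.
rewrite mulrDr mul_exprS_div // Ea Eo exprD [(unknot * z) ^+ _]exprMn mulrDr; congr (_ + _).
  exact: mul_shuffle.
by rewrite mulrCA.
Qed.

(** * Decorated torus links *)

Definition cabled_crossing (c : bool) : diagram := crossings 0 2 2 c.
Definition cabled_pow (c : bool) (m : nat) : diagram :=
  flatten (nseq m (cabled_crossing c)).

Lemma trace_labels_crossings c m a b s tbl D :
  trace_labels (nseq m (0%N, Cross c) ++ D) [:: a, b & s] tbl
    = trace_labels D (if odd m then [:: b, a & s] else [:: a, b & s]) tbl.
Proof. by elim: m a b => //= m IH a b; rewrite drop0 IH if_neg. Qed.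

(** Sign and absolute value of the exponent are separated: [T2 n] is the case where c is the truth
    value of 0 <= n and m is the absolute value of n. *)
Definition torus2 (c : bool) (m : nat) : diagram :=
  closed_braid 2 (nseq m (0%N, Cross c)).

Lemma cup_labels_torus2 c m :
  cup_labels (torus2 c m) = if odd m then [:: 0; 0]%N else [:: 0; 1]%N.
Proof.
by rewrite /cup_labels /torus2 /closed_braid /= trace_labels_crossings; case: odd.
Qed.

Lemma decorate_crossings T lbl n c m a b s D :
  size (T a).1 = 2%N -> size (T b).1 = 2%N ->
  decorate_rec T lbl n [:: a, b & s] (nseq m (0%N, Cross c) ++ D)
    = cabled_pow c m ++
      decorate_rec T lbl n (if odd m then [:: b, a & s] else [:: a, b & s]) D.
Proof.
move=> Ta Tb; elim: m a b Ta Tb => //= m IH a b Ta Tb.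
by rewrite drop0 Ta Tb IH // if_neg.
Qed.

Definition twist (e : bool) : annular := ([:: true; true], [:: (0%N, Cross e)]).

Lemma P_elt2 : P_elt 2 = [:: (z / qbr 2, twist false); (z / qbr 2, twist true)].
Proof. by []. Qed.

(** The twist is inserted just above the first doubled cup, hence below the second pair of cups. The
    parity of m makes this a knot, so only one twist appears. *)
Lemma decorate_odd c m T e : odd m -> T 0%N = twist e ->
  decorate (torus2 c m) T
    = [:: (0%N, Cup true); (1%N, Cup true); (0%N, Cross e);
          (2%N, Cup true); (3%N, Cup true)]
      ++ cabled_pow c m ++ closure_caps 4.
Proof.
move=> odd_m T0; rewrite /decorate cup_labels_torus2 odd_m /torus2 /closed_braid.
rewrite /= !T0 /= decorate_crossings ?T0 // odd_m /= !T0 /=.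
by [].
Qed.

Lemma decorate_even c m T e e' : ~~ odd m -> T 0%N = twist e ->
  T 1%N = twist e' ->
  decorate (torus2 c m) T
    = [:: (0%N, Cup true); (1%N, Cup true); (0%N, Cross e);
          (2%N, Cup true); (3%N, Cup true)]
      ++ ((2%N, Cross e') :: cabled_pow c m) ++ closure_caps 4.
Proof.
move=> /negPf odd_m T0 T1.
rewrite /decorate cup_labels_torus2 odd_m /torus2 /closed_braid.
rewrite /= !T0 !T1 /= decorate_crossings ?T0 ?T1 // odd_m /= !T0 ?T1 /=.
by [].
Qed.

Lemma braid_cabled_pow c m : braid 3 (cabled_pow c m).
Proof. by rewrite /cabled_pow; elim: m. Qed.

(** This and the next identity match the nested sums produced by [star_rec]: the powers of [2] in
    [Zcheck] cancel the denominators of [P_elt 2]. *)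
Lemma mul_div_sum2 (K : fieldType) (b a x y : K) : b != 0 ->
  b ^+ 1 * (a / b * 1 * x + (a / b * 1 * y + 0)) = a * (y + x).
Proof. by move=> b0; field. Qed.

Lemma mul_div_sum4 (K : fieldType) (b a x y x' y' : K) : b != 0 ->
  b ^+ 2 * (a / b * (a / b * 1) * x + (a / b * (a / b * 1) * y +
    (a / b * (a / b * 1) * x' + (a / b * (a / b * 1) * y' + 0))))
  = a ^+ 2 * (y' + x' + y + x).
Proof. by move=> b0; field. Qed.

Definition four_closure (H : diagram -> Qqt) (w : diagram) : Qqt :=
  H (closed_braid 4 w).

Section Zcheck.
Variables (H : diagram -> Qqt) (HH : framed_homfly H).

Local Notation F := (four_closure H).

(** Two exchanges of height lift the twist above the last two cups, which turns the decorated
    diagram into a closed 4-braid. *)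
Lemma homfly_decorated v e : braid 3 v ->
  H ([:: (0%N, Cup true); (1%N, Cup true); (0%N, Cross e);
         (2%N, Cup true); (3%N, Cup true)] ++ v ++ closure_caps 4)
    = F ((0%N, Cross e) :: v).
Proof.
move=> Bv.
have link D : run [::] D = Some (closure_level 4) ->
    is_link (D ++ v ++ closure_caps 4).
  move=> ED; rewrite /is_link (run_cat _ ED) (run_cat _ (run_braid Bv)).
  exact: run_closure_caps.
have L1 := link [:: (0%N, Cup true); (1%N, Cup true); (0%N, Cross e);
         (2%N, Cup true); (3%N, Cup true)] erefl.
have L2 := link [:: (0%N, Cup true); (1%N, Cup true); (2%N, Cup true);
         (0%N, Cross e); (3%N, Cup true)] erefl.
have L3 := link [:: (0%N, Cup true); (1%N, Cup true); (2%N, Cup true);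
         (3%N, Cup true); (0%N, Cross e)] erefl.
have S1 := homfly_far HH (D := [:: (0%N, Cup true); (1%N, Cup true)])
  (D' := (3%N, Cup true) :: v ++ closure_caps 4) (n := 2%N) (p := 0%N) isT L2 L1.
have S2 := homfly_far HH
  (D := [:: (0%N, Cup true); (1%N, Cup true); (2%N, Cup true)])
  (D' := v ++ closure_caps 4) (n := 3%N) (p := 0%N) isT L3 L2.
by rewrite /four_closure /closed_braid; rewrite /= in S1 S2 *; rewrite -S1 -S2.
Qed.

Lemma Zcheck_odd c m : odd m ->
  Zcheck H 2 (torus2 c m) =
  z * (F ((0%N, Cross true) :: cabled_pow c m)
       + F ((0%N, Cross false) :: cabled_pow c m)).
Proof.
move=> odd_m; rewrite /Zcheck /star /components cup_labels_torus2 odd_m P_elt2.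
rewrite [undup _]/= [star_rec _ _ _ _]/= /lin_ext !big_cons big_nil.
have E T e : T 0%N = twist e ->
    F ((0%N, Cross e) :: cabled_pow c m) = H (decorate (torus2 c m) T).
  move=> T0; rewrite (decorate_odd c odd_m T0).
  by rewrite homfly_decorated ?braid_cabled_pow.
rewrite (E (fun b => if b == 0%N then twist false else ([::], [::])) false) //.
rewrite (E (fun b => if b == 0%N then twist true else ([::], [::])) true) //.
by rewrite -(mul_div_sum2 _ _ _ (qbr_neq0 (isT : 0 < 2)%N)).
Qed.

Lemma Zcheck_even c m : ~~ odd m ->
  Zcheck H 2 (torus2 c m) =
  z ^+ 2 * (F [:: (0%N, Cross true), (2%N, Cross true) & cabled_pow c m]
       + F [:: (0%N, Cross true), (2%N, Cross false) & cabled_pow c m]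
       + F [:: (0%N, Cross false), (2%N, Cross true) & cabled_pow c m]
       + F [:: (0%N, Cross false), (2%N, Cross false) & cabled_pow c m]).
Proof.
move=> even_m.
rewrite /Zcheck /star /components cup_labels_torus2 (negPf even_m) P_elt2.
rewrite [undup _]/= [star_rec _ _ _ _]/= /lin_ext !big_cons big_nil.
have E T e e' : T 0%N = twist e -> T 1%N = twist e' ->
    F [:: (0%N, Cross e), (2%N, Cross e') & cabled_pow c m]
      = H (decorate (torus2 c m) T).
  move=> T0 T1; rewrite (decorate_even c even_m T0 T1).
  by rewrite homfly_decorated // braid_cons braid_cabled_pow.
(* [star_rec] treats component 0 first, so the test for component 1 is the outer one. *)
pose T e e' b := if b == 1%N then twist e' else
  if b == 0%N then twist e else ([::], [::]).
rewrite (E (T true true) true true) // (E (T true false) true false) //.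
rewrite (E (T false true) false true) // (E (T false false) false false) //.
by rewrite -(mul_div_sum4 _ _ _ _ _ (qbr_neq0 (isT : 0 < 2)%N)).
Qed.
End Zcheck.

(** * The recurrence *)

(** The extreme coefficients are 1 and -1, so the recurrence can be solved for its last and for its
    first term: a window of five consecutive values in [S] propagates in both directions. *)
Lemma palindromic_recurrence_mem (R : comNzRingType) (S : R -> Prop)
    (SD : forall x y, S x -> S y -> S (x + y))
    (SB : forall x y, S x -> S y -> S (x - y))
    (SM : forall x y, S x -> S y -> S (x * y))
    (c1 c2 : R) (Sc1 : S c1) (Sc2 : S c2) (a : int -> R) :
  (forall k, a (k + 5) - c1 * a (k + 4) + c2 * a (k + 3) - c2 * a (k + 2)
     + c1 * a (k + 1) - a k = 0) ->
  (forall j : nat, (j < 5)%N -> S (a j)) -> forall k, S (a k).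
Proof.
move=> rec_a init.
pose W k := [/\ S (a k), S (a (k + 1)), S (a (k + 2)), S (a (k + 3))
  & S (a (k + 4))].
have up k : W k -> W (k + 1).
  case=> S0 S1 S2 S3 S4.
  rewrite /W -!addrA; split => //.
  have -> : a (k + (1 + 4)) = a k - c1 * a (k + 1) + c2 * a (k + 2)
      - c2 * a (k + 3) + c1 * a (k + 4).
    apply/eqP; rewrite -subr_eq0 -[X in _ == X](rec_a k); apply/eqP.
    by rewrite (_ : 1 + 4 = 5) //; ring.
  apply: (SD) (SM _ _ Sc1 S4); apply: (SB) (SM _ _ Sc2 S3).
  by apply: (SD) (SM _ _ Sc2 S2); apply: (SB) (SM _ _ Sc1 S1).
have down k : W (k + 1) -> W k.
  rewrite /W -!addrA => -[S1 S2 S3 S4 S5]; split => //.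
  have -> : a k = a (k + (1 + 4)) - c1 * a (k + (1 + 3)) + c2 * a (k + (1 + 2))
      - c2 * a (k + (1 + 1)) + c1 * a (k + 1).
    apply/eqP; rewrite -subr_eq0 -oppr_eq0 -[X in _ == X](rec_a k); apply/eqP.
    rewrite (_ : 1 + 4 = 5) // (_ : 1 + 3 = 4) // (_ : 1 + 2 = 3) //.
    by rewrite (_ : 1 + 1 = 2) //; ring.
  apply: (SD) (SM _ _ Sc1 S1); apply: (SB) (SM _ _ Sc2 S2).
  by apply: (SD) (SM _ _ Sc2 S3); apply: (SB) (SM _ _ Sc1 S4).
have W0 : W 0 by split; rewrite ?add0r; apply: init.
suff all_W k : W k by move=> k; case: (all_W k).
elim/int_rec: k => // n IH; first by rewrite -addn1 PoszD; apply: up.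
by apply: down; rewrite -addn1 PoszD opprD addrNK.
Qed.

Definition cabled_int (n : int) : diagram :=
  match n with
  | Posz m => cabled_pow true m
  | Negz m => cabled_pow false m.+1
  end.

Definition beta : seq nat := [:: 1; 2; 0; 1]%N.

(** The negative cable lists its positions in the same order 1, 2, 0, 1 as the positive one. The
    inner letters 1 cancel first; exchanging the distant letters 0 and 2 then makes the remaining
    pairs adjacent. *)
Lemma hf_cabled_cancel (R : comNzRingType) (h : R) g u v :
  hecke_fun h 3 g -> braid 3 u -> braid 3 v ->
  g (u ++ cabled_crossing true ++ cabled_crossing false ++ v) = g (u ++ v).
Proof.
move=> Hg Bu Bv.
have E1 := @hf_RII _ _ _ _ Hg (u ++ [:: sigma 1; sigma 2; sigma 0])
  [:: (2%N, Cross false), (0%N, Cross false), (1%N, Cross false) & v] 1%N true.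
have E2 := @hf_far _ _ _ _ Hg (u ++ [:: sigma 1; sigma 2])
  [:: (0%N, Cross false), (1%N, Cross false) & v] 0%N 2%N true false.
have E3 := @hf_RII _ _ _ _ Hg (u ++ [:: sigma 1])
  [:: (0%N, Cross true), (0%N, Cross false), (1%N, Cross false) & v] 2%N true.
have E4 := @hf_RII _ _ _ _ Hg (u ++ [:: sigma 1])
  [:: (1%N, Cross false) & v] 0%N true.
have E5 := @hf_RII _ _ _ _ Hg u v 1%N true.
rewrite -!catA /= in E1 E2 E3 E4 E5.
by rewrite [LHS]E1 ?E2 ?E3 ?E4 ?E5 ?braid_cat ?Bu.
Qed.

(* multiplication by sigma + sigma^-1 = 2 sigma - X *)
Definition decoration (n p : nat) (x : hecke n) : hecke n :=
  hadd (hscale [:: 2%coqZ] (hmul p x)) (hscale [:: 0%coqZ; (-1)%coqZ] x).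

Lemma hval_decoration (R : comNzRingType) (h : R) n p (x : hecke n) g :
  hecke_fun h n g -> (p < n)%N ->
  hval h (decoration p x) g = hval h x (fun u => g (u ++ [:: (p, Cross true)]))
    + hval h x (fun u => g (u ++ [:: (p, Cross false)])).
Proof.
move=> Hg lt_pn; rewrite hval_add !hval_scale hval_mul //=.
(* The skein relation replaces the negative crossing by the positive one minus h. *)
have -> : hval h x (fun u => g (u ++ [:: (p, Cross false)]))
   = hval h x (fun u => g (u ++ [:: (p, Cross true)]) + (- h) * g u).
  apply: eq_hval => u Bu; have := hf_skein Hg Bu (isT : braid n [::]) lt_pn.
  by rewrite cats0 => E; rewrite mulNr -E opprB addrCA subrr addr0.
rewrite hval_addf hval_scalef zeval0 /sigma.
have -> : zeval R 2 = 2 by [].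
have -> : zeval R (-1) = -1 by [].
ring.
Qed.

Definition knot_cable : hecke 3 := decoration 0 (hecke1 3).
Definition link_cable : hecke 3 := decoration 2 knot_cable.

Definition bmul (n : nat) (x : hecke 3) : hecke 3 :=
  iter n (fun y : hecke 3 => hmuls y beta) x.

Definition zX2 := zp_mul zX zX.
(* q^4 + q^-4 and q^8 + q^-8 in terms of X = q - q^-1 *)
Definition cheb4 : zpoly := [:: 2; 0; 4; 0; 1]%coqZ.
Definition cheb8 : zpoly := zp_add (zp_mul cheb4 cheb4) [:: -2]%coqZ.
(** Expanding the annihilating polynomial of y gives y^5 - [rec1] y^4 + [rec2] y^3 - [rec2] y^2 +
    [rec1] y - 1. *)
Definition rec1 : zpoly := zp_add (zp_add cheb8 cheb4) [:: 1]%coqZ.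
Definition rec2 : zpoly := zp_add rec1 (zp_add (zp_mul cheb8 cheb4) [:: 1]%coqZ).
Definition hsub (n : nat) (x y : hecke n) := hadd x (hscale [:: -1]%coqZ y).

(* the values 1, q^8, q^-8, q^4, q^-4 of the square of the cabled crossing
   in the irreducible representations are the roots *)
Definition rec_comb (x0 x1 x2 x3 x4 x5 : hecke 3) : hecke 3 :=
  hsub (hadd (hscale rec1 x1)
    (hsub (hadd (hscale rec2 x3) (hsub x5 (hscale rec1 x4))) (hscale rec2 x2))) x0.

Definition rec_elt (x : hecke 3) : hecke 3 :=
  rec_comb x (bmul 2 x) (bmul 4 x) (bmul 6 x) (bmul 8 x) (bmul 10 x).

Lemma palindromic_sum_div (K : fieldType) (m c1 c2 a0 a1 a2 a3 a4 a5 : K) :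
  a5 / m - c1 * (a4 / m) + c2 * (a3 / m) - c2 * (a2 / m) + c1 * (a1 / m) - a0 / m
  = (c1 * a1 + (c2 * a3 + (a5 - c1 * a4) - c2 * a2) - a0) / m.
Proof. ring. Qed.

(** * The two defects as functions of the exponent, and their divisibility *)

Section Main.
Variables (H : diagram -> Qqt) (HH : framed_homfly H).

Local Notation F := (four_closure H).
Let F_hecke : hecke_fun z 3 F := homfly_hecke_fun HH 3.

Definition cable_val (x : hecke 3) (n : int) : Qqt :=
  hval z x (fun u => F (u ++ cabled_int n)).

Lemma braid_cabled_int n : braid 3 (cabled_int n).
Proof. by case: n => n; apply: braid_cabled_pow. Qed.

Lemma cable_fun n : hecke_fun z 3 (fun u => F (u ++ cabled_int n)).
Proof. by apply: hecke_fun_catr F_hecke _; apply: braid_cabled_int. Qed.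

(** [beta] spells the positive cabled crossing: it lengthens a nonnegative power and cancels one
    factor of a negative one. *)
Lemma cable_val_beta x n : cable_val (hmuls x beta) n = cable_val x (n + 1).
Proof.
rewrite /cable_val (hval_muls _ (cable_fun n)) //; apply: eq_hval => u Bu.
rewrite -catA -/(cabled_crossing true); case: n => [m|[|m]].
- by rewrite -PoszD addn1.
- by rewrite (hf_cabled_cancel F_hecke (v := [::])).
- have -> : Negz m.+1 + 1 = Negz m by rewrite !NegzE; lia.
  exact: (hf_cabled_cancel F_hecke Bu (braid_cabled_pow false m.+1)).
Qed.

Lemma cable_val_bmul j x n : cable_val (bmul j x) n = cable_val x (n + j%:Z).
Proof.
elim: j n => [|j IH] n; first by rewrite addr0.
by rewrite /bmul iterS cable_val_beta IH -addrA -PoszD add1n.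
Qed.

Lemma cable_val_add x y n :
  cable_val (hadd x y) n = cable_val x n + cable_val y n.
Proof. exact: hval_add. Qed.

Lemma cable_val_scale c x n :
  cable_val (hscale c x) n = pev z c * cable_val x n.
Proof. exact: hval_scale. Qed.

Lemma cable_val_sub x y n :
  cable_val (hsub x y) n = cable_val x n - cable_val y n.
Proof.
rewrite /hsub cable_val_add cable_val_scale /= mulr0 addr0.
by have -> : zeval Qqt (-1) = -1 by []; rewrite mulN1r.
Qed.

Lemma cable_val_rec_comb x0 x1 x2 x3 x4 x5 n a1 a2 a3 a4 a5 :
  cable_val x1 n = a1 -> cable_val x2 n = a2 -> cable_val x3 n = a3 ->
  cable_val x4 n = a4 -> cable_val x5 n = a5 ->
  cable_val (rec_comb x0 x1 x2 x3 x4 x5) n =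
    pev z rec1 * a1 + (pev z rec2 * a3 + (a5 - pev z rec1 * a4)
      - pev z rec2 * a2) - cable_val x0 n.
Proof.
move=> <- <- <- <- <-.
rewrite /rec_comb cable_val_sub cable_val_add cable_val_scale cable_val_sub.
by rewrite cable_val_add cable_val_scale cable_val_sub !cable_val_scale.
Qed.

Lemma Zcheck_T2 n : Zcheck H 2 (T2 n) =
  if odd `|n|%N then z * cable_val knot_cable n else z ^+ 2 * cable_val link_cable n.
Proof.
have E c m : (if odd m then z * (F ((0%N, Cross true) :: cabled_pow c m)
       + F ((0%N, Cross false) :: cabled_pow c m)) else 
  z ^+ 2 * (F [:: (0%N, Cross true), (2%N, Cross true) & cabled_pow c m]
       + F [:: (0%N, Cross true), (2%N, Cross false) & cabled_pow c m]
       + F [:: (0%N, Cross false), (2%N, Cross true) & cabled_pow c m]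
       + F [:: (0%N, Cross false), (2%N, Cross false) & cabled_pow c m]))
   = Zcheck H 2 (torus2 c m).
  by case: ifPn => om; [rewrite (Zcheck_odd HH) | rewrite (Zcheck_even HH)].
have -> : Zcheck H 2 (T2 n) = Zcheck H 2 (torus2 (0 <= n) `|n|%N).
  by case: n.
rewrite -E.
have -> : cabled_pow (0 <= n) `|n|%N = cabled_int n by case: n.
case: ifP => _; congr (_ * _).
  by rewrite /cable_val (hval_decoration _ (cable_fun n)) // !hval_hecke1.
(* Expanding the decoration at position 2 leaves that letter, with either sign, to the right of the
   decoration at position 0 still to be expanded. *)
have Hc c := hecke_fun_catr (cable_fun n) (isT : braid 3 [:: (2%N, Cross c)]).
rewrite /cable_val (hval_decoration _ (cable_fun n)) //.
rewrite (hval_decoration _ (Hc true)) // (hval_decoration _ (Hc false)) //.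
by rewrite !hval_hecke1 /= addrACA !addrA.
Qed.

Lemma z2D4_neq0 : z ^+ 2 + 4 != 0.
Proof.
rewrite -qcurl2_sqr; apply: expf_neq0; apply: mulf_neq0; first exact: qbr_neq0.
by rewrite invr_eq0; apply: qbr_neq0.
Qed.

(** This reduces integrality for all k to finite computations: the vanishing of one Hecke element
    gives the recurrence in k, and the five tests at k = 0, ..., 4 start it. The argument 4 of
    [trace_dvd] is the power of [unknot] for four strands. *)
Lemma cable_val_integral s b x : hzero (rec_elt x) ->
  all (fun j => trace_dvd s b 4 (htrace (bmul (2 * j) x))) (iota 0 5) ->
  forall k : int, in_Zz2t (cable_val x (2 * k) / (z ^+ s * (z ^+ 2 + 4) ^+ b)).
Proof.
move=> rec_x dvd_x.
have m0 : z ^+ s * (z ^+ 2 + 4) ^+ b != 0.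
  by apply: mulf_neq0; apply: expf_neq0; [exact: z_neq0 | exact: z2D4_neq0].
apply: (palindromic_recurrence_mem Zz2tD Zz2tB Zz2tM
  (c1 := pev z rec1) (c2 := pev z rec2)); try exact: Zz2t_even.
- move=> k; have : cable_val (rec_elt x) (2 * k) = 0 := hval_zero z _ rec_x.
  have B j := cable_val_bmul j x (2 * k).
  rewrite (cable_val_rec_comb _ (B 2) (B 4) (B 6) (B 8) (B 10)).
  have E5 : 2 * (k + 5) = 2 * k + 10%:Z by ring.
  have E4 : 2 * (k + 4) = 2 * k + 8%:Z by ring.
  have E3 : 2 * (k + 3) = 2 * k + 6%:Z by ring.
  have E2 : 2 * (k + 2) = 2 * k + 4%:Z by ring.
  have E1 : 2 * (k + 1) = 2 * k + 2%:Z by ring.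
  rewrite E5 E4 E3 E2 E1 => E.
  by rewrite palindromic_sum_div E mul0r.
- move=> j lt_j; have : j \in iota 0 5 by rewrite mem_iota.
  move/(allP dvd_x)/trace_dvdP=> [Q ZQ EQ].
  (* For j >= 0 the power of the cabled crossing is absorbed into the Hecke element by [bmul], so
     the value is a single Markov trace. *)
  have -> : cable_val x (2 * j%:Z) = z ^+ s * (z ^+ 2 + 4) ^+ b * Q.
    rewrite -EQ -(hval_homfly HH unknot_neq0) -[2 * _]add0r -PoszM.
    rewrite -cable_val_bmul; apply: eq_hval => u _.
    by rewrite cats0.
  by rewrite mulrAC divff // mul1r.
Qed.

(** Left side minus right side of the first congruence, with exponents shifted so that only
    nonnegative powers of [beta] occur; the weights z and z^2 are those of [Zcheck_T2]. *)
Definition knot_defect (x y : hecke 3) : hecke 3 :=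
  hadd (hscale zX (hsub (bmul 3 x) (bmul 1 x))) (hscale zX2 (bmul 2 y)).

(** The same for the second congruence; the last scalar is 2 [2]^2 z, with [2]^2 = z^2 (z^2 + 4). *)
Definition link_defect (x y : hecke 3) : hecke 3 :=
  hadd (hscale zX2 (hsub (bmul 2 y) y))
    (hscale (zp_mul (zp_scale 2 zX) (zp_mul zX2 [:: 4; 0; 1]%coqZ)) (bmul 1 x)).

Lemma pev_zX2 : pev z zX2 = z ^+ 2.
Proof. by rewrite pev_mul pev_zX expr2. Qed.

Lemma cable_val_knot_defect x y n : cable_val (knot_defect x y) n =
  z * (cable_val x (n + 3%:Z) - cable_val x (n + 1%:Z))
    + z ^+ 2 * cable_val y (n + 2%:Z).
Proof.
rewrite /knot_defect cable_val_add cable_val_scale cable_val_sub.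
by rewrite 2!cable_val_bmul cable_val_scale cable_val_bmul pev_zX pev_zX2.
Qed.

Lemma cable_val_link_defect x y n : cable_val (link_defect x y) n =
  z ^+ 2 * (cable_val y (n + 2%:Z) - cable_val y n)
    + 2 * z * (z ^+ 2 * (z ^+ 2 + 4)) * cable_val x (n + 1%:Z).
Proof.
rewrite /link_defect cable_val_add cable_val_scale cable_val_sub.
rewrite cable_val_bmul cable_val_scale cable_val_bmul pev_zX2.
rewrite pev_mul pev_mul pev_zX2.
have -> : pev z (zp_scale 2 zX) = 2 * z by rewrite pev_scale pev_zX.
have -> // : pev z [:: 4; 0; 1]%coqZ = z ^+ 2 + 4.
by rewrite /= zeval0 zeval1 mulr0 addr0 mulr1 add0r addrC.
Qed.

(** The exponents 0 and 1 encode {2}^2 = z^2 + 4. Both hypotheses of the criterion are closed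
    boolean computations. *)
Lemma knot_defect_integral (k : int) :
  in_Zz2t (cable_val (knot_defect knot_cable link_cable) (2 * k)
           / (z ^+ 0 * (z ^+ 2 + 4) ^+ 1)).
Proof. by apply: cable_val_integral; vm_compute. Qed.

(** The exponents 2 and 2 encode {2}^2 [2]^2 = z^2 (z^2 + 4)^2. *)
Lemma link_defect_integral (k : int) :
  in_Zz2t (cable_val (link_defect knot_cable link_cable) (2 * k)
           / (z ^+ 2 * (z ^+ 2 + 4) ^+ 2)).
Proof. by apply: cable_val_integral; vm_compute. Qed.

End Main.

Theorem theorem1p8 (H : diagram -> Qqt) (HH : framed_homfly H) (k : int) :
  congr_mod (Zcheck H 2 (T2 (2 * k + 1)) - Zcheck H 2 (T2 (2 * k - 1)))
            (- Zcheck H 2 (T2 (2 * k)))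
            (qcurl 2 ^+ 2)
  /\
  congr_mod (Zcheck H 2 (T2 (2 * k)) - Zcheck H 2 (T2 (2 * k - 2)))
            (- (2 * qbr 2 ^+ 2 * Zcheck H 2 (T2 (2 * k - 1))))
            (qcurl 2 ^+ 2 * qbr 2 ^+ 2).
Proof.
have odd_p : odd (absz (2 * k + 1)%R) by lia.
have odd_m : odd (absz (2 * k - 1)%R) by lia.
have even_0 : odd (absz (2 * k)%R) = false by lia.
have even_m : odd (absz (2 * k - 2)%R) = false by lia.
rewrite !(Zcheck_T2 HH) odd_p odd_m even_0 even_m /congr_mod !opprK.
rewrite qbr2_sqr qcurl2_sqr.
(* The defects are indexed from their lowest even exponent, here 2k - 2, so they are taken at k -
   1. *)
have E0 : 2 * (k - 1) = 2 * k - 2 by ring.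
have E1 : 2 * k - 2 + 1%:Z = 2 * k - 1 by ring.
have E2 : 2 * k - 2 + 2%:Z = 2 * k by ring.
have E3 : 2 * k - 2 + 3%:Z = 2 * k + 1 by ring.
split.
  have := knot_defect_integral HH (k - 1).
  by rewrite (cable_val_knot_defect HH) E0 E1 E2 E3 expr0 expr1 mul1r mulrBr.
have := link_defect_integral HH (k - 1).
rewrite (cable_val_link_defect HH) E0 E1 E2 mulrBr.
have -> : (z ^+ 2 + 4) * (z ^+ 2 * (z ^+ 2 + 4)) = z ^+ 2 * (z ^+ 2 + 4) ^+ 2.
  by rewrite mulrCA -expr2.
by rewrite [2 * z * _]mulrAC -[_ * z * cable_val _ knot_cable _]mulrA.
Qed.
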